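(* The typical continuous function on $[0,1]$ has Property (b'). That is, the set of all $f\in C[0,1]$ such that for each $x_0\in[0,1]$ the set $$E=\left\{x\in[0,1]\setminus\{x_0\}:\frac{f(x)-f(x_0)}{x-x_0}\geq0\right\}$$ does not have zero density at $x_0$ is residual in $C[0,1]$.
   Context: $C[0,1]$ is the complete metric space of all continuous functions $f:[0,1]\to\mathbb{R}$ with the sup metric. A subset of $C[0,1]$ is residual if its complement is of the first Baire category (meager) in $C[0,1]$; a property is typical if the set of functions enjoying it is residual. With $\lambda$ denoting Lebesgue measure on $\mathbb{R}$, the density of a measurable set $E$ in an interval $I$ is $\Delta(E,I)=\lambda(E\cap I)/\lambda(I)$; the upper density of $E$ at $x$ is $\overline\Delta(E,x)=\limsup_{r\to0}\Delta(E,(x-r,x+r))$, with $r>0$. The lower density is defined with $\liminf$, and if the two agree the common value is the density of $E$ at $x$. Thus $E$ does not have zero density at $x_0$ precisely when $\overline\Delta(E,x_0)>0$. *)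

(* Defs.v *)
From HB Require Import structures.
From mathcomp Require Import all_boot all_order all_algebra.
From mathcomp Require Import all_classical all_reals all_analysis.

Set Implicit Arguments.
Unset Strict Implicit.
Unset Printing Implicit Defensive.

Import Order.TTheory GRing.Theory Num.Theory.
Import numFieldNormedType.Exports.

Local Open Scope classical_set_scope.
Local Open Scope ring_scope.

Section Category.
Context {T : topologicalType}.
Implicit Types A : set T.

Definition nowhere_dense A := (closure A)° = set0.

Definition meager A := exists2 F : (set T)^nat,
  (forall n, nowhere_dense (F n)) & A = \bigcup_n F n.

Definition residual A := meager (~` A).

End Category.

Definition unit_interval (R : realType) : set R := `[0, 1].
Arguments unit_interval R : clear implicits.

(* The domain is the sigma type of [0, 1] with the induced topology, so that
   elements are equal as soon as they agree on [0, 1]. *)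
Definition C01 (R : realType) := continuousType (unit_interval R) R.

HB.instance Definition _ (R : realType) := Choice.on (C01 R).

Section SupMetric.
Context {R : realType}.
Implicit Types f g h : C01 R.

Definition sup_dist f g : R := sup (range (fun x => `|f x - g x|)).

Let unit_interval0 : unit_interval R 0.
Proof. by rewrite /unit_interval /= in_itv /= lexx ler01. Qed.

Let pt0 : unit_interval R := SigSub (mem_set unit_interval0).

Lemma sup_dist_has_sup f g : has_sup (range (fun x => `|f x - g x|)).
Proof.
have cd : continuous (fun x : unit_interval R => `|f x - g x|).
  move=> x; apply: (@continuous_comp _ _ _ (fun x => f x - g x) Num.norm).
    by apply: continuousB; exact: cts_fun.
  exact: norm_continuous.
have /subspace_valL_continuousP cd' := cd.
have [|c _ cmax] := compact_EVT_max _ (@segment_compact R 0 1) cd'.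
  by exists 0; exact: unit_interval0.
split; first by exists `|f pt0 - g pt0|, pt0.
exists (valL (fun x : unit_interval R => `|f x - g x|) c) => _ [x _ <-].
have /cmax : val x \in `[0 : R, 1]%classic by exact: valP.
by congr (_ <= _); exact: (congr1 (@^~ x)
  (valLK point (fun x : unit_interval R => `|f x - g x|))).
Qed.

Lemma sup_dist_ub f g x : `|f x - g x| <= sup_dist f g.
Proof. by apply: sup_upper_bound; [exact: sup_dist_has_sup|exists x]. Qed.

Lemma sup_dist_le f g (d : R) :
  (forall x, `|f x - g x| <= d) -> sup_dist f g <= d.
Proof.
move=> fgd; apply: ge_sup; first by have [] := sup_dist_has_sup f g.
by move=> _ [x _ <-].
Qed.

Let sup_distxx f : sup_dist f f = 0.
Proof.
apply/eqP; rewrite eq_le; apply/andP; split.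
  by apply: sup_dist_le => x; rewrite subrr normr0.
exact: le_trans (sup_dist_ub f f pt0).
Qed.

Let sup_dist_positivity f g : sup_dist f g = 0 -> f = g.
Proof.
move=> fg0; apply/continuousEP => x; apply/eqP.
by rewrite -subr_eq0 -normr_le0 -fg0; exact: sup_dist_ub.
Qed.

Let sup_dist_sym f g : sup_dist f g = sup_dist g f.
Proof. by congr sup; apply: eq_imagel => x _; rewrite distrC. Qed.

Let sup_dist_triangle g f h : sup_dist f h <= sup_dist f g + sup_dist g h.
Proof.
apply: sup_dist_le => x; rewrite (le_trans (ler_distD (g x) _ _))//.
by rewrite lerD// sup_dist_ub.
Qed.

HB.instance Definition _ := isMetric.Build R (C01 R)
  sup_distxx sup_dist_positivity sup_dist_sym sup_dist_triangle.

End SupMetric.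

Section Density.
Context {R : realType}.
Implicit Types (E I : set R) (x : R).
Local Open Scope ereal_scope.

Definition density_in E I : \bar R :=
  lebesgue_measure (E `&` I) / lebesgue_measure I.

Definition upper_density E x : \bar R :=
  limf_esup (fun r : R => density_in E `](x - r)%R, (x + r)%R[) 0^'+.

Definition lower_density E x : \bar R :=
  limf_einf (fun r : R => density_in E `](x - r)%R, (x + r)%R[) 0^'+.

Definition has_density E x (d : \bar R) :=
  upper_density E x = d /\ lower_density E x = d.

End Density.

Definition nonneg_slope_set {R : realType} (f : C01 R)
    (x0 : unit_interval R) : set R :=
  [set val x | x in
    [set x | x <> x0 /\ 0 <= (f x - f x0) / (val x - val x0)]].

(* Main.v *)
Require Import Defs.
From HB Require Import structures.
From mathcomp Require Import all_boot all_order all_algebra.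
From mathcomp Require Import all_classical all_reals all_analysis.
From mathcomp Require Import ring lra.

(** If the set [E] of nonnegative slopes of [f] from [x0] has density zero
    at [x0], then for every threshold [q > 0] there is an [n] such that [E] fills
    less than a fraction [q] of every interval centred at [x0] of radius below
    [1 / (n + 1)].  Call such an [f] uniformly sparse.  It suffices to find one
    [q] for which the uniformly sparse functions form, for every [n], a nowhere
    dense set.

    Given [f] and [e], add to [f] the fast wave [x |-> (e / 2) * wave (N * x)],
    where [wave y = - cos (pi * y)] and [N] is a large odd integer.  The wave
    has the following property, which persists under small perturbations.  At a
    point where the wave is nonnegative, the last trough on the left gives a
    whole interval of points to the left with much lower values; where the wave
    is negative, the next crest on the right gives an interval of points to the
    right with much higher values.  Both kinds of points have positive slope.
    The length of the interval and its distance to the point are of order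
    [1 / N], so it occupies a fixed proportion of an interval of radius
    [3 / N].  Since [f] hardly varies at the scale [1 / N], the slopes keep
    their sign for every function close enough to the perturbed one.

    The ends of [0, 1] are the delicate points, because only one side is
    available there.  The wave starts at a trough in 0 and, [N] being odd, ends
    at a crest in 1, so that the trough or crest in question always lies in
    [0, 1] ([wave_window]).  The perturbation argument is
    [wave_defeats_sparsity]. *)

Import Order.TTheory GRing.Theory Num.Theory.
Import numFieldNormedType.Exports.

Local Open Scope classical_set_scope.
Local Open Scope ring_scope.

(** * Troughs and crests of a cosine wave *)

Definition wave {R : realType} (y : R) : R := - cos (pi * y).

Lemma wave_continuous (R : realType) : continuous (@wave R).
Proof.
move=> y; apply: continuousN; apply: continuous_comp; last exact: continuous_cos.
exact: mulrl_continuous.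
Qed.

Lemma wave_le1 {R : realType} (y : R) : `|wave y| <= 1.
Proof. by rewrite normrN ler_norml cos_geN1 cos_le1. Qed.

Lemma wave_even {R : realType} (i : nat) (y : R) :
  wave (i.*2%:R + y) = wave y.
Proof.
rewrite /wave mulrDr addrC mulr_natr (alternatingn (@cosDpi R)).
by rewrite -signr_odd odd_double expr0 mul1r.
Qed.

(** The half-turn about the centre of [0, 2m + 1] exchanges left and right,
    troughs and crests. *)
Lemma wave_odd_sym {R : realType} (m : nat) (y : R) :
  wave (m.*2.+1%:R - y) = - wave y.
Proof.
rewrite /wave mulrBr addrC mulr_natr (alternatingn (@cosDpi R)).
by rewrite -signr_odd /= odd_double expr1 mulN1r cosN.
Qed.

(** The troughs are the even integers.  If [wave y >= 0], then [y] is not near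
    the last even integer below it, so the whole right half of that trough
    lies to the left of [y]. *)
Lemma wave_trough (R : realType) : exists2 c : R, 0 < c &
  forall y : R, 0 <= y -> 0 <= wave y -> exists a : R,
    [/\ 0 <= a, y - 2 <= a, a + c < y &
        forall z : R, a <= z <= a + c -> wave z <= - 2^-1].
Proof.
have wave0 : wave 0 = -1 :> R by rewrite /wave mulr0 cos0.
have : \forall z \near (0 : R), wave z < - 2^-1.
  have := @wave_continuous R 0; rewrite /continuous_at wave0 => /cvgr_lt; apply.
  lra.
move=> /nbhs_ballP[c /= c0 cP].
have low u : 0 <= u <= c / 2 -> wave u < - 2^-1.
  move=> /andP[u0 uc]; apply: cP; rewrite /ball /= sub0r normrN ger0_norm//; lra.
exists (c / 2) => [|y y0 wy]; first by rewrite divr_gt0.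
pose i := Num.truncn (y / 2).
have /andP[iy yi] : i%:R <= y / 2 < i.+1%:R by apply: truncn_itv; rewrite divr_ge0.
have eqi : i.*2%:R = 2 * i%:R :> R by rewrite -mul2n natrM.
have eqy : i.*2%:R + (y - i.*2%:R) = y by ring.
rewrite -[i.+1]addn1 natrD in yi.
exists i.*2%:R; split.
- exact: ler0n.
- rewrite eqi; lra.
- rewrite ltNge; apply/negP => h.
  have : wave (y - i.*2%:R) < - 2^-1 by apply: low; rewrite eqi in h *; lra.
  by rewrite -(wave_even i) eqy; lra.
- move=> z /andP[z1 z2].
  have <- : i.*2%:R + (z - i.*2%:R) = z by ring.
  by rewrite wave_even; apply/ltW/low; lra.
Qed.

(** The case [wave y < 0] is the case [wave y >= 0] after the half-turn.  The
    bounds [0 <= a] and [a + c <= 2m + 1], which keep the window inside the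
    domain even when [y] is an end point, use that [2m + 1] is odd. *)
Lemma wave_window (R : realType) : exists2 c : R, 0 < c &
  forall (m : nat) (y : R), 0 <= y <= m.*2.+1%:R -> exists a : R,
    [/\ 0 <= a, a + c <= m.*2.+1%:R, y - 2 <= a, a + c <= y + 2 &
      (forall z, a <= z <= a + c -> z < y /\ wave z - wave y <= - 2^-1) \/
      (forall z, a <= z <= a + c -> y < z /\ 2^-1 <= wave z - wave y)].
Proof.
have [c c0 cP] := wave_trough R; exists c => // m y /andP[y0 ym].
have [wy|/ltW wy] := leP 0 (wave y).
  have [a [a0 ya ay aP]] := cP y y0 wy; exists a; split; try lra.
  by left=> z za; have := aP z za; case/andP: za => *; split; lra.
have [||a [a0 ya ay aP]] := cP (m.*2.+1%:R - y).
- lra.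
- by rewrite wave_odd_sym; lra.
exists (m.*2.+1%:R - a - c); split; try lra.
right=> z /andP[za1 za2]; have := aP (m.*2.+1%:R - z).
by rewrite wave_odd_sym => zP; split; lra.
Qed.

(** * Density *)

(** The comparison of [[a, b]] with [E] goes through the outer measure that
    underlies the Lebesgue measure and is monotone on all sets. *)
Lemma density_in_ge {R : realType} (E : set R) (x r a b : R) :
  0 < r -> a <= b -> x - r < a -> b < x + r -> `[a, b] `<=` E ->
  (((b - a) / (2 * r))%:E <= density_in E `](x - r)%R, (x + r)%R[)%E.
Proof.
move=> r0 ab xa bx abE; rewrite /density_in lebesgue_measure_itv/= lte_fin.
rewrite ifT; last by lra.
have -> : ((x + r)%:E - (x - r)%:E)%E = (2 * r)%:E.
  by rewrite -EFinB; congr EFin; ring.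
rewrite inver gt_eqF; last by lra.
rewrite EFinM; apply: lee_wpmul2r; first by rewrite lee_fin invr_ge0; lra.
have -> : (b - a)%:E = lebesgue_measure `[a, b].
  rewrite lebesgue_measure_itv/= lte_fin; case: ltP => //.
  by move=> ba; have -> : b - a = 0 by lra.
rewrite /lebesgue_measure /lebesgue_stieltjes_measure /measure_extension.
apply: le_outer_measure => z zab; split; first exact: abE.
by move: zab; rewrite /= !in_itv /=; lra.
Qed.

Lemma zero_density_small {R : realType} {E : set R} {x q : R} :
  has_density E x 0%E -> 0 < q ->
  exists n : nat, forall r : R, 0 < r < n.+1%:R^-1 ->
    (density_in E `](x - r)%R, (x + r)%R[ < q%:E)%E.
Proof.
move=> [ud _] q0; move: ud; rewrite /upper_density limf_esupE => ud.
have : (ereal_inf [set ereal_sup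
      [set density_in E `](x - r)%R, (x + r)%R[ | r in V]
    | V in (0^'+ : set_system R)] < q%:E)%E by rewrite ud lte_fin.
move=> /ereal_inf_lt[_ [V V0 <-] Vq].
move: V0 => /nbhs_ballP [d /= d0 dV].
pose n := Num.bound d^-1.
have nd : n.+1%:R^-1 < d.
  have dn : d^-1 < n%:R by apply: archi_boundP; rewrite invr_ge0 ltW.
  by rewrite invf_plt ?posrE// (lt_le_trans dn)// ler_nat.
exists n => r /andP[r0 rn]; apply: le_lt_trans Vq; apply: ereal_sup_ubound.
exists r => //; apply: dV => //=; rewrite /ball /= sub0r normrN gtr0_norm//.
exact: lt_trans rn nd.
Qed.

(** * Perturbing a continuous function by a wave *)

(** Pointwise continuity gives local moduli, which [near_covering] of the
    compact [0, 1] merges into one. *)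
Lemma C01_unif_continuous {R : realType} (f : C01 R) (e : R) : 0 < e ->
  exists2 d : R, 0 < d &
    forall x y : unit_interval R, `|val x - val y| < d -> `|f x - f y| < e.
Proof.
move=> e0.
have loc (x : unit_interval R) : exists2 d, 0 < d &
    forall y : unit_interval R, `|val x - val y| < d -> `|f x - f y| < e / 2.
  have e20 : 0 < e / 2 by rewrite divr_gt0.
  have /cvgr_dist_lt /(_ (e / 2) e20) := @cts_fun _ _ f x.
  move=> /nbhs_ballP [d /= d0 dP]; exists d => // y; exact: dP.
(* Coverings are available for [0, 1] as a subset of [R], so the property is
   stated for a real [x'] and applies to the points of value [x']. *)
pose P (d x' : R) := forall x y : unit_interval R, val x = x' ->
  `|val x - val y| < d -> `|f x - f y| < e.
have Ploc (x0 : R) : `[0, 1]%classic x0 ->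
    \forall x' \near x0 & d \near 0^'+, P d x'.
  move=> x01; have [d d0 dP] := loc (SigSub (mem_set x01)).
  exists (ball x0 (d / 2), [set r : R | r < d / 2]).
    split; first by apply: nbhsx_ballx; rewrite divr_gt0.
    by apply: nbhs_right_lt; rewrite divr_gt0.
  move=> [x' r] /= [bx' rd] x y xx' xy.
  rewrite /ball /= -xx' in bx'.
  have fx : `|f (SigSub (mem_set x01)) - f x| < e / 2 by apply: dP => /=; lra.
  have fy : `|f (SigSub (mem_set x01)) - f y| < e / 2.
    apply: dP => /=; have := ler_distD (val x) x0 (val y); lra.
  rewrite distrC in fx.
  have := ler_distD (f (SigSub (mem_set x01))) (f x) (f y); lra.
have /compact_near_coveringP cov := @segment_compact R 0 1.
have : \forall d \near 0^'+, 0 < d /\ `[(0 : R), 1]%classic `<=` P d.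
  by apply: filterI; [exact: nbhs_right_gt | exact: (cov _ _ P _ Ploc)].
move=> /filter_ex [d [d0 dP]]; exists d => // x y.
exact: (dP (val x) (set_valP x)).
Qed.

Lemma add_wave_continuous {R : realType} (f : C01 R) (a k : R) :
  continuous (fun x : unit_interval R => f x + a * wave (k * val x)).
Proof.
move=> x; apply: continuousD; first exact: cts_fun.
apply: continuousM; first exact: cst_continuous.
apply: (@continuous_comp _ _ _ (val : unit_interval R -> R)
  (fun t => wave (k * t))); first exact: initial_continuous.
apply: (@continuous_comp _ _ _ ( *%R k) wave); first exact: mulrl_continuous.
exact: wave_continuous.
Qed.

Definition add_wave {R : realType} (f : C01 R) (a k : R) : C01 R :=
  mkcts (add_wave_continuous f a k).

Lemma add_waveE {R : realType} (f : C01 R) (a k : R) (x : unit_interval R) :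
  add_wave f a k x = f x + a * wave (k * val x).
Proof. by []. Qed.

Lemma sup_dist_add_wave {R : realType} (f : C01 R) (a k : R) (a0 : 0 <= a) :
  sup_dist f (add_wave f a k) <= a.
Proof.
apply: sup_dist_le => x; rewrite add_waveE opprD addNKr normrN normrM ger0_norm//.
by rewrite ler_piMr// wave_le1.
Qed.

(** These sets cover the functions having a point of zero density: the radius
    below which the density is under [q] is made uniform in [f] and [x0]. *)
Definition uniformly_sparse {R : realType} (q : R) (n : nat) : set (C01 R) :=
  [set f | exists x0 : unit_interval R, forall r : R, 0 < r < n.+1%:R^-1 ->
    (density_in (nonneg_slope_set f x0)
       `](val x0 - r)%R, (val x0 + r)%R[ < q%:E)%E].

(** The window of length [c] given by [wave_window] around [N * x0], rescaled
    by [1 / N], fills the proportion [c / 6] of the interval of radius [3 / N]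
    around [x0].  On it the wave of amplitude [e / 2] differs from its value at
    [x0] by at least [e / 4], in the direction of a positive slope, whereas the
    variation of [f] (below [e / 16]) and the distance from [g] to [h] (below
    [e / 32], counted at both points) amount to less than [e / 8]. *)
Lemma wave_defeats_sparsity (R : realType) : exists2 q : R, 0 < q &
  forall (n : nat) (f : C01 R) (e : R), 0 < e -> exists g : C01 R,
    sup_dist f g < e /\ exists2 d : R, 0 < d &
      forall h : C01 R, sup_dist g h < d -> ~ uniformly_sparse q n h.
Proof.
have [c c0 cP] := wave_window R; exists (c / 6) => [|n f e e0].
  by rewrite divr_gt0.
have [//|w w0 fw] := C01_unif_continuous f (e / 16); first by rewrite divr_gt0.
(* [N] makes [3 / N < 1 / (n + 1)] and [2 / N] smaller than the modulus [w]. *)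
pose m := Num.bound (2 / w + 3 * n.+1%:R).
pose N : R := m.*2.+1%:R.
have mN : 2 / w + 3 * n.+1%:R < N.
  have mb : 2 / w + 3 * n.+1%:R < m%:R.
    by apply: archi_boundP; rewrite addr_ge0 ?divr_ge0 ?mulr_ge0 ?ltW.
  by rewrite (lt_le_trans mb)// ler_nat -addnn -addSn leq_addl.
have N0 : 0 < N by rewrite ltr0n.
have w20 : 0 < 2 / w by rewrite divr_gt0.
have n0 : 0 < n.+1%:R :> R by rewrite ltr0n.
have Nw : 2 / N < w by rewrite ltr_pdivrMr// mulrC -ltr_pdivrMr//; lra.
have Nn : 3 / N < n.+1%:R^-1 by rewrite ltr_pdivrMr// mulrC ltr_pdivlMr//; lra.
exists (add_wave f (e / 2) N); split.
  have e20 : 0 <= e / 2 by lra.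
  have := sup_dist_add_wave f (e / 2) N e20; lra.
exists (e / 32) => [|h gh [x0 x0P]]; first by rewrite divr_gt0.
have x01 : 0 <= val x0 <= 1 by have := set_valP x0; rewrite /unit_interval /= in_itv.
have [|a [a0 aN xa ax aP]] := cP m (N * val x0).
  by case/andP: x01 => x0ge x0le; rewrite mulr_ge0 ?ler_piMr// ltW.
have := x0P (3 / N); rewrite Nn divr_gt0// => /(_ isT); apply/negP; rewrite -leNgt.
have -> : c / 6 = ((a + c) / N - a / N) / (2 * (3 / N)) by field; lra.
have Na : N * (a / N) = a by field; lra.
have Nac : N * ((a + c) / N) = a + c by field; lra.
have N3 : N * (3 / N) = 3 by field; lra.
apply: density_in_ge.
- exact: divr_gt0.
- by rewrite ler_pM2r ?invr_gt0//; lra.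
- by rewrite -(ltr_pM2l N0) mulrBr N3 Na; lra.
- by rewrite -(ltr_pM2l N0) mulrDr N3 Nac; lra.
move=> z; rewrite /= in_itv/= -(ler_pM2l N0) -[X in _ && X](ler_pM2l N0) Na Nac.
move=> zN.
have z01 : unit_interval R z.
  rewrite /unit_interval /= in_itv /= -(ler_pM2l N0) -[X in _ && X](ler_pM2l N0).
  by rewrite mulr0 mulr1; lra.
pose z' : unit_interval R := SigSub (mem_set z01).
have vz : val z' = z by [].
have zx : `|val z' - val x0| < w.
  apply: le_lt_trans Nw; rewrite -(ler_pM2l N0).
  have -> : N * (2 / N) = 2 by field; lra.
  by rewrite -{1}(gtr0_norm N0) -normrM mulrBr ler_norml vz; lra.
have fzx := fw _ _ zx.
have hz := le_lt_trans (sup_dist_ub _ _ z') gh.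
have hx := le_lt_trans (sup_dist_ub _ _ x0) gh.
rewrite !add_waveE in hz hx.
rewrite vz in hz; move: hz hx fzx; rewrite !ltr_norml => hz hx fzx.
exists z' => //; split.
  by move=> zx0; case: aP => /(_ _ zN)[]; rewrite -zx0 vz ltxx.
rewrite vz; case: aP => /(_ _ zN)[]; rewrite (ltr_pM2l N0) => zx0 wz.
  by rewrite -mulrNN -invrN divr_ge0//; nra.
by rewrite divr_ge0//; nra.
Qed.

(** * Category *)

Lemma uniformly_sparse_nowhere_dense (R : realType) : exists2 q : R, 0 < q &
  forall n, nowhere_dense (@uniformly_sparse R q n).
Proof.
have [q q0 qP] := wave_defeats_sparsity R; exists q => // n.
rewrite /nowhere_dense -subset0 => f.
move=> /nbhs_ballP[e /= e0 fe].
have [g [fg [d d0 gP]]] := qP n f e e0.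
have /(_ (ball g d)) [|h [hB gh]] : closure (uniformly_sparse q n) g by exact: fe.
  exact: nbhsx_ballx.
exact: gP gh hB.
Qed.

Theorem theorem1 (R : realType) :
  residual [set f : C01 R | forall x0 : unit_interval R,
    ~ has_density (nonneg_slope_set f x0) (val x0) 0%E].
Proof.
have [q q0 qP] := uniformly_sparse_nowhere_dense R.
set G := [set f | _].
(* A meager set is an exact union of nowhere dense sets, hence the
   intersection with the complement of [G]. *)
exists (fun n => uniformly_sparse q n `&` ~` G).
  move=> n; rewrite /nowhere_dense -subset0 -(qP n).
  by apply/interiorS/closureS; exact: subIsetl.
rewrite -setI_bigcupl; apply/seteqP; split=> [f Gf|f []//].
split=> //; move: Gf => /existsNP[x0 /contrapT dx0].
have [n nP] := zero_density_small dx0 q0.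
by exists n => //; exists x0.
Qed.
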